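(* Let $\mathbb{F}=\mathbb{R}$ or $\mathbb{C}$, let $A\in\mathbb{F}^{n\times n}$ be Hermitian and invertible, let $\mathcal{S}$ be a $p$-dimensional linear subspace of $\mathbb{F}^n$ with $1\le p\le n$, and let $\omega_{\min}:=-\lambda_{\min}(A)$. For $b\in\mathbb{F}^n$ and $\omega>\omega_{\min}$ let $x_{b,\omega}:=\operatorname*{arg\,min}_{x\in\mathcal{S}}\|(A+\omega I)^{-1/2}(b-Ax)\|_2$, and let $\mathcal{X}_b$ be the affine hull of $\{x_{b,\omega}:\omega>\omega_{\min}\}$. Assume $\mathrm{Ind}_A(\mathcal{S})\ge1$. Then the set $\{b\in\mathbb{F}^n:\dim(\mathcal{X}_b)=0\}$ is a non-trivial (i.e. different from $\{0\}$) linear subspace of $\mathbb{F}^n$ that has $n$-dimensional (resp. $2n$-dimensional) Lebesgue measure zero in $\mathbb{F}^n$ for $\mathbb{F}=\mathbb{R}$ (resp. $\mathbb{F}=\mathbb{C}$).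
   Context: $\mathrm{Ind}_A(\mathcal{S}):=\dim(\mathcal{S}+A\mathcal{S})-\dim(\mathcal{S})$. $\lambda_{\min}(A)$ is the smallest eigenvalue of $A$. For $\omega>\omega_{\min}$, $A+\omega I$ is Hermitian positive definite, its power $-1/2$ is defined via the spectral decomposition, and the minimizer $x_{b,\omega}$ exists and is unique. *)

(* Defs.v *)
From HB Require Import structures.
From mathcomp Require Import all_boot all_order all_algebra.
From mathcomp Require Import all_classical all_reals all_analysis.
From mathcomp Require Import complex.

Set Implicit Arguments.
Unset Strict Implicit.
Unset Printing Implicit Defensive.
Import Order.TTheory GRing.Theory Num.Theory.

Local Open Scope classical_set_scope.
Local Open Scope ring_scope.

Inductive scalar_kind := RealScalars | ComplexScalars.

Definition scalars (R : realType) (k : scalar_kind) : numFieldType :=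
  match k with
  | RealScalars => R
  | ComplexScalars => R[i]
  end.

Section Scalars.
Context {R : realType}.

Definition of_real k : R -> scalars R k :=
  match k with
  | RealScalars => fun x => x
  | ComplexScalars => fun x => x%:C%C
  end.

Definition conj_scalar k : scalars R k -> scalars R k :=
  match k with
  | RealScalars => fun x => x
  | ComplexScalars => fun z => conjc z
  end.

Definition abs_scalar k : scalars R k -> R :=
  match k with
  | RealScalars => fun x => `|x|
  | ComplexScalars => fun z => ComplexField.Normc.normc z
  end.

End Scalars.

(** n-dimensional Lebesgue measure on the Borel sets of R^n, obtained by
    iterating the binary product measure; R^0 carries the unit point mass. *)
Section LebesgueMeasureN.
Context (R : realType).
Let RT := measurableTypeR R.

Definition tuple_cons n (xt : RT * n.-tuple RT) : n.+1.-tuple RT :=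
  [tuple of xt.1 :: xt.2].

Fixpoint lebesgue_measure_n (n : nat) : set (n.-tuple RT) -> \bar R :=
  match n with
  | 0 => dirac [tuple]
  | m.+1 => pushforward
      (product_measure1 (@lebesgue_measure R) (@lebesgue_measure_n m))
      (@tuple_cons m)
  end.

Lemma measurable_tuple_cons n : measurable_fun setT (@tuple_cons n).
Proof. exact: measurable_cons. Qed.

Let uncons n (t : n.+1.-tuple RT) : RT * n.-tuple RT :=
  (thead t, [tuple of behead t]).

Let measurable_uncons n : measurable_fun setT (@uncons n).
Proof.
apply: measurable_fun_pair; last exact: measurable_behead.
exact: measurable_tnth.
Qed.

Let lebesgue_measure_n_spec n :
  exists mu : {sigma_finite_measure set (n.-tuple RT) -> \bar R},
    @lebesgue_measure_n n = mu.
Proof.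
elim: n => [|n [mu IH]] /=; first by exists (dirac [tuple]).
pose nu : {measure set (RT * n.-tuple RT)%type -> \bar R} :=
  product_measure1 (@lebesgue_measure R) mu.
have @rho : {measure set (n.+1.-tuple RT) -> \bar R}.
  by refine (pushforward nu (@tuple_cons n) : {measure set _ -> \bar R});
    exact: measurable_tuple_cons.
have sf : sigma_finite setT rho.
  have /sigma_finiteP[F [TF ndF Foo]] := sigma_finiteT (@lebesgue_measure R).
  have /sigma_finiteP[G [TG ndG Goo]] := sigma_finiteT mu.
  exists (fun i => @uncons n @^-1` (F i `*` G i)).
    apply/esym; rewrite -preimage_bigcup -subTset => t _ /=.
    have : [set: RT] (uncons t).1 by [].
    have : [set: n.-tuple RT] (uncons t).2 by [].
    rewrite TF TG => -[j _ Gj] [i _ Fi]; exists (maxn i j) => //; split.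
    - by move: (uncons t).1 Fi; exact/subsetPset/ndF/leq_maxl.
    - by move: (uncons t).2 Gj; exact/subsetPset/ndG/leq_maxr.
  move=> i; have [mF Fi] := Foo i; have [mG Gi] := Goo i; split.
    rewrite -[X in measurable X]setTI.
    by apply: measurable_uncons => //; exact: measurableX.
  rewrite /rho/= /pushforward.
  have -> : @tuple_cons n @^-1` (@uncons n @^-1` (F i `*` G i)) = F i `*` G i.
    apply: funext => -[x t]; rewrite /= /uncons theadE.
    by congr (_ /\ G i _); exact: val_inj.
  by rewrite [ltLHS]product_measure1E// lte_mul_pinfty// ge0_fin_numE.
pose S := HB.pack_for {sigma_finite_measure set (n.+1.-tuple RT) -> \bar R}
  (rho : set _ -> \bar R) (Measure.class rho)
  (Measure_isSigmaFinite.Build _ _ _ rho sf).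
by exists S; rewrite IH.
Qed.

Let lebesgue_measure_n0 n : @lebesgue_measure_n n set0 = 0%E.
Proof. by have [mu ->] := lebesgue_measure_n_spec n. Qed.

Let lebesgue_measure_n_ge0 n A : (0 <= @lebesgue_measure_n n A)%E.
Proof. by have [mu ->] := lebesgue_measure_n_spec n. Qed.

Let lebesgue_measure_n_semi_sigma_additive n :
  semi_sigma_additive (@lebesgue_measure_n n).
Proof.
by have [mu ->] := lebesgue_measure_n_spec n; exact: measure_semi_sigma_additive.
Qed.

HB.instance Definition _ n := isMeasure.Build _ _ _ (@lebesgue_measure_n n)
  (lebesgue_measure_n0 n) (@lebesgue_measure_n_ge0 n)
  (@lebesgue_measure_n_semi_sigma_additive n).

Let lebesgue_measure_n_sigma_finite n : sigma_finite setT (@lebesgue_measure_n n).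
Proof.
by have [mu ->] := lebesgue_measure_n_spec n; exact: sigma_finiteT.
Qed.

HB.instance Definition _ n := Measure_isSigmaFinite.Build _ _ _
  (@lebesgue_measure_n n) (@lebesgue_measure_n_sigma_finite n).

Lemma lebesgue_measure_n_box n (B : 'I_n -> set RT) :
  (forall i, measurable (B i)) ->
  @lebesgue_measure_n n [set t | forall i, B i (tnth t i)] =
  (\prod_(i < n) lebesgue_measure (B i))%E.
Proof.
elim: n B => [|n IH] B mB.
  by rewrite big_ord0 /= diracE mem_set// => -[].
rewrite big_ord_recl -IH => [|i]; last exact: mB.
rewrite [LHS]/= /pushforward -product_measure1E//; last first.
  rewrite [X in measurable X](_ : _ =
    \bigcap_(i in [set: 'I_n]) (fun t => tnth t i) @^-1` B (lift ord0 i)).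
    apply: fin_bigcap_measurable => // i _.
    by rewrite -[X in measurable X]setTI; exact: measurable_tnth.
  by apply/seteqP; split=> t /= h i; [move=> _; exact: h|exact: (h i I)].
congr (_ _); apply/seteqP; split=> -[x t] /=.
- move=> h; split; first exact: (h ord0).
  by move=> i; have := h (lift ord0 i); rewrite tnthS.
- by move=> [hx ht] i; case: (unliftP ord0 i) => [j ->|-> //]; rewrite tnthS; exact: ht.
Qed.

End LebesgueMeasureN.

Section NullSets.
Context {R : realType}.
Local Notation RT := (measurableTypeR R).

(** F^n is identified with R^n when F = R, and with R^(2n) (real parts followed
    by imaginary parts) when F = C. *)
Definition real_dim (k : scalar_kind) (n : nat) : nat :=
  match k with
  | RealScalars => n
  | ComplexScalars => n + n
  end.

Definition real_coords k n :
    'cV[scalars R k]_n -> (real_dim k n).-tuple RT :=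
  match k return 'cV[scalars R k]_n -> (real_dim k n).-tuple RT with
  | RealScalars => fun v => [tuple v i 0 | i < n]
  | ComplexScalars => fun v =>
      [tuple of [tuple complex.Re (v i 0) | i < n]
             ++ [tuple complex.Im (v i 0) | i < n]]
  end.

(** [negligible] is measure zero for the completed (i.e. Lebesgue) measure: the
    set is contained in a Borel set of measure zero. *)
Definition lebesgue_null k n (E : set 'cV[scalars R k]_n) : Prop :=
  (@lebesgue_measure_n R (real_dim k n)).-negligible (@real_coords k n @` E).

End NullSets.

Section AffineHull.
Context {F : fieldType} {V : vectType F}.

Definition affine_hull (X : set V) : set V :=
  [set y | exists m (c : 'I_m -> F) (x : 'I_m -> V),
    [/\ forall i, X (x i), \sum_i c i = 1 & y = \sum_i c i *: x i]].

Definition has_affine_dim (X : set V) (d : nat) : Prop :=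
  exists (x0 : V) (U : {vspace V}),
    \dim U = d /\ X = [set x0 + u | u in [set u | u \in U]].

End AffineHull.

Section Problem.
Context {R : realType} {k : scalar_kind} {n : nat}.
Local Notation F := (scalars R k).

Definition adjoint_mx m (A : 'M[F]_(m, n)) : 'M[F]_(n, m) :=
  (map_mx (@conj_scalar R k) A)^T.

Definition is_hermitian (A : 'M[F]_n) : Prop := adjoint_mx A = A.

Definition l2norm (v : 'cV[F]_n) : R :=
  Num.sqrt (\sum_i (abs_scalar (v i 0)) ^+ 2).

(** For Hermitian [A] and 0 < n, the set below is a singleton: all eigenvalues
    are real, and the order of [F] extends that of [R]. *)
Definition lambda_min (A : 'M[F]_n) : R :=
  xget 0 [set l : R | eigenvalue A (of_real k l) /\
                      forall m : F, eigenvalue A m -> of_real k l <= m].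

Definition omega_min (A : 'M[F]_n) : R := - lambda_min A.

(** Power of a Hermitian positive definite matrix: if A = U diag(d) U^* with U
    unitary and d real, then A^s = U diag(d^s) U^*; this matrix does not depend
    on the chosen spectral decomposition. *)
Definition hpd_power (A : 'M[F]_n) (s : R) : 'M[F]_n :=
  xget 0 [set P | exists (U : 'M[F]_n) (d : 'rV[R]_n),
    [/\ U *m adjoint_mx U = 1%:M,
        A = U *m diag_mx (map_mx (@of_real R k) d) *m adjoint_mx U &
        P = U *m diag_mx (\row_j of_real k (d 0 j `^ s)) *m adjoint_mx U]].

Definition shifted_mx (A : 'M[F]_n) (w : R) : 'M[F]_n := A + (of_real k w)%:M.

Definition objective (A : 'M[F]_n) (b : 'cV[F]_n) (w : R) (x : 'cV[F]_n) : R :=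
  l2norm (hpd_power (shifted_mx A w) (- 2^-1) *m (b - A *m x)).

Definition minimizer (A : 'M[F]_n) (S : {vspace 'cV[F]_n})
    (b : 'cV[F]_n) (w : R) : 'cV[F]_n :=
  xget 0 [set x | x \in S /\
                  forall y, y \in S -> objective A b w x <= objective A b w y].

Definition minimizer_hull (A : 'M[F]_n) (S : {vspace 'cV[F]_n})
    (b : 'cV[F]_n) : set 'cV[F]_n :=
  affine_hull [set minimizer A S b w | w in [set w | omega_min A < w]].

Definition Ind (A : 'M[F]_n) (S : {vspace 'cV[F]_n}) : nat :=
  (\dim (S + linfun (mulmx A) @: S)%VS - \dim S)%N.

End Problem.

(* Main.v *)
Require Import Defs.
From HB Require Import structures.
From mathcomp Require Import all_boot all_order all_algebra.
From mathcomp Require Import all_classical all_reals all_analysis.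
From mathcomp Require Import complex measurable_realfun.
From mathcomp Require Import zify lra.

Set Implicit Arguments.
Unset Strict Implicit.
Unset Printing Implicit Defensive.
Import Order.TTheory GRing.Theory Num.Theory.
Local Open Scope classical_set_scope.
Local Open Scope ring_scope.

(** For w > omega_min the minimizer x is the unique element of S whose residual
    b - A x satisfies (A + w)^-1 (b - A x) _|_ A S. Hence the minimizer does not
    depend on w iff one x in S satisfies these linear conditions for all w
    simultaneously, so the set B of such b is a subspace; it contains A S <> 0.

    B is proper: if B were everything, take u _|_ T := A S and b := (A + w1) u.
    At w1 the condition reads (A + w1)^-1 A x _|_ T, so A x = 0 by positive
    definiteness; at w2 it then gives (A + w2)^-1 u _|_ T. So (A + w2)^-1
    preserves the orthogonal complement of T, hence also T, and A T <= T, i.e.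
    A S <= S, which contradicts Ind_A(S) >= 1. Finally a vector r <> 0 orthogonal
    to B places B in the real hyperplane Re <r, v> = 0, which is null by Fubini. *)

(** * Uniform arithmetic of real and complex scalars *)

Section ScalarTheory.
Context {R : realType} {k : scalar_kind}.
Local Notation F := (scalars R k).
Local Notation conj := (@conj_scalar R k).
Local Notation re := (@of_real R k).

Fact conj_scalar_zmod_morphism : zmod_morphism conj.
Proof. by rewrite /conj_scalar; case: k => //= x y; rewrite rmorphB. Qed.

Fact conj_scalar_monoid_morphism : monoid_morphism conj.
Proof.
by rewrite /conj_scalar; case: k => //=; split=> [|x y]; rewrite ?rmorph1 ?rmorphM.
Qed.

HB.instance Definition _ :=
  GRing.isZmodMorphism.Build F F conj conj_scalar_zmod_morphism.
HB.instance Definition _ :=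
  GRing.isMonoidMorphism.Build F F conj conj_scalar_monoid_morphism.

Fact of_real_zmod_morphism : zmod_morphism re.
Proof. by rewrite /of_real; case: k => //= x y; rewrite rmorphB. Qed.

Fact of_real_monoid_morphism : monoid_morphism re.
Proof.
by rewrite /of_real; case: k => //=; split=> [|x y]; rewrite ?rmorph1 ?rmorphM.
Qed.

HB.instance Definition _ :=
  GRing.isZmodMorphism.Build R F re of_real_zmod_morphism.
HB.instance Definition _ :=
  GRing.isMonoidMorphism.Build R F re of_real_monoid_morphism.

Lemma conj_scalarK : involutive conj.
Proof. by rewrite /conj_scalar; case: k => // x; rewrite conjcK. Qed.

Lemma conj_of_real x : conj (re x) = re x.
Proof. by rewrite /conj_scalar /of_real; case: k => //=; rewrite oppr0. Qed.

Lemma of_real_le x y : (re x <= re y) = (x <= y).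
Proof. by rewrite /of_real; case: k => //; rewrite lecR. Qed.

Lemma of_real_abs_sqr x : re (abs_scalar x ^+ 2) = conj x * x.
Proof.
move: x; rewrite /of_real /abs_scalar /conj_scalar; case: k => x.
  by rewrite real_normK ?num_real// expr2.
by rewrite rmorphXn /= -[_%:C%C]/`|x| sqr_normc mulrC.
Qed.

Lemma of_real_inj : injective re.
Proof. exact: fmorph_inj. Qed.

Lemma abs_scalar_eq0 x : abs_scalar x = 0 -> x = 0 :> F.
Proof.
move: x; rewrite /abs_scalar; case: k => x.
  by move/eqP; rewrite normr_eq0 => /eqP.
exact: ComplexField.Normc.eq0_normc.
Qed.

(** Embedding into an algebraically closed field, so that the existence of eigenvalues is proved
    once for both kinds of scalars. *)
Definition to_complex : F -> R[i] :=
  match k with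
  | RealScalars => fun x => x%:C%C
  | ComplexScalars => fun z => z
  end.

Fact to_complex_zmod_morphism : zmod_morphism to_complex.
Proof. by rewrite /to_complex; case: k => //= x y; rewrite rmorphB. Qed.

Fact to_complex_monoid_morphism : monoid_morphism to_complex.
Proof.
by rewrite /to_complex; case: k => //=; split=> [|x y]; rewrite ?rmorph1 ?rmorphM.
Qed.

HB.instance Definition _ :=
  GRing.isZmodMorphism.Build F R[i] to_complex to_complex_zmod_morphism.
HB.instance Definition _ :=
  GRing.isMonoidMorphism.Build F R[i] to_complex to_complex_monoid_morphism.

Lemma to_complex_conj x : to_complex (conj x) = (to_complex x)^*%C.
Proof.
by move: x; rewrite /to_complex /conj_scalar; case: k => x //=; rewrite oppr0.
Qed.

Lemma to_complex_of_real x : to_complex (re x) = x%:C%C.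
Proof. by rewrite /to_complex /of_real; case: k. Qed.

End ScalarTheory.

(** * Adjoints, Euclidean norm and least squares *)

Section AdjointTheory.
Context {R : realType} {k : scalar_kind}.
Local Notation F := (scalars R k).
Local Notation re := (@of_real R k).

Lemma adjoint_mxM m n p (A : 'M[F]_(m, n)) (B : 'M[F]_(n, p)) :
  adjoint_mx (A *m B) = adjoint_mx B *m adjoint_mx A.
Proof. by rewrite /adjoint_mx map_mxM trmx_mul. Qed.

Lemma adjoint_mxD m n (A B : 'M[F]_(m, n)) :
  adjoint_mx (A + B) = adjoint_mx A + adjoint_mx B.
Proof. by rewrite /adjoint_mx map_mxD linearD. Qed.

Lemma adjoint_mxK m n (A : 'M[F]_(m, n)) : adjoint_mx (adjoint_mx A) = A.
Proof. by apply/matrixP=> i j; rewrite !mxE conj_scalarK. Qed.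

Lemma adjoint_mx0 m n : adjoint_mx (0 : 'M[F]_(m, n)) = 0.
Proof. by rewrite /adjoint_mx map_mx0 trmx0. Qed.

Lemma adjoint_row_mx m n1 n2 (A : 'M[F]_(m, n1)) (B : 'M[F]_(m, n2)) :
  adjoint_mx (row_mx A B) = col_mx (adjoint_mx A) (adjoint_mx B).
Proof. by rewrite /adjoint_mx map_row_mx tr_row_mx. Qed.

Lemma adjoint_diag_real n (d : 'rV[R]_n) :
  adjoint_mx (diag_mx (map_mx re d)) = diag_mx (map_mx re d).
Proof.
apply/matrixP=> i j; rewrite !mxE rmorphMn /= conj_of_real eq_sym.
by case: eqVneq => // ->.
Qed.

Definition norm_sqr n (v : 'cV[F]_n) : R := \sum_i abs_scalar (v i 0) ^+ 2.

Lemma norm_sqr_ge0 n (v : 'cV[F]_n) : 0 <= norm_sqr v.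
Proof. by apply: sumr_ge0 => i _; exact: sqr_ge0. Qed.

Lemma norm_sqr_eq0 n (v : 'cV[F]_n) : norm_sqr v = 0 -> v = 0.
Proof.
move=> /psumr_eq0P h; apply/colP => i; rewrite mxE; apply: abs_scalar_eq0.
by apply/eqP; rewrite -sqrf_eq0 h// => j _; exact: sqr_ge0.
Qed.

Lemma adjoint_mulmx_norm_sqr n (v : 'cV[F]_n) :
  adjoint_mx v *m v = (re (norm_sqr v))%:M.
Proof.
apply/matrixP=> i j; rewrite !ord1 !mxE eqxx mulr1n rmorph_sum.
by apply: eq_bigr => l _; rewrite [RHS]of_real_abs_sqr !mxE.
Qed.

Lemma adjoint_mulmx_self_eq0 n (v : 'cV[F]_n) : adjoint_mx v *m v = 0 -> v = 0.
Proof.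
rewrite adjoint_mulmx_norm_sqr => /matrixP/(_ 0 0)/eqP.
by rewrite !mxE eqxx mulr1n fmorph_eq0 => /eqP/norm_sqr_eq0.
Qed.

Lemma adjoint_mulmx_eq0 m n (G : 'M[F]_(m, n)) (v : 'cV[F]_n) :
  adjoint_mx G *m G *m v = 0 -> G *m v = 0.
Proof.
move=> h; apply: adjoint_mulmx_self_eq0.
by rewrite adjoint_mxM -mulmxA [X in _ *m X]mulmxA h mulmx0.
Qed.

Lemma norm_sqrD_orthogonal n (u v : 'cV[F]_n) :
  adjoint_mx u *m v = 0 -> norm_sqr (u + v) = norm_sqr u + norm_sqr v.
Proof.
move=> uv; have vu : adjoint_mx v *m u = 0.
  by rewrite -[u]adjoint_mxK -adjoint_mxM uv adjoint_mx0.
apply: (@of_real_inj R k).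
have := adjoint_mulmx_norm_sqr (u + v).
rewrite adjoint_mxD mulmxDl !mulmxDr uv vu addr0 add0r !adjoint_mulmx_norm_sqr.
by rewrite -raddfD => /matrixP/(_ 0 0); rewrite !mxE eqxx !mulr1n rmorphD.
Qed.

(** [G^* G] and [G] have the same kernel, so [G^* G] has the rank of [G^*]. Its column space
    therefore equals that of [G^*] and contains [G^* y]. The transposes turn column spaces into the
    row spaces compared by [<=]. *)
Lemma normal_equation_solvable m n (G : 'M[F]_(m, n)) (y : 'cV[F]_m) :
  exists c : 'cV[F]_n, adjoint_mx G *m (y - G *m c) = 0.
Proof.
pose M := adjoint_mx G *m G.
have rM : (\rank (adjoint_mx G) <= \rank M)%N.
  rewrite -[\rank (adjoint_mx G)]mxrank_tr /adjoint_mx trmxK mxrank_map.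
  have : (kermx M^T <= kermx G^T)%MS.
    apply/sub_kermxP/row_matrixP => i; rewrite row_mul row0.
    have : row i (kermx M^T) *m M^T = 0 by rewrite -row_mul mulmx_ker row0.
    move=> /(congr1 trmx); rewrite trmx_mul trmxK trmx0 => /adjoint_mulmx_eq0.
    by move=> /(congr1 trmx); rewrite trmx_mul trmxK trmx0.
  move=> /mxrankS; rewrite !mxrank_ker !mxrank_tr.
  by have := rank_leq_col M; have := rank_leq_col G; lia.
have sM : (M^T <= (adjoint_mx G)^T)%MS by rewrite /M trmx_mul submxMl.
have : ((adjoint_mx G)^T <= M^T)%MS 
  by rewrite -(geq_leqif (mxrank_leqif_sup sM)) (mxrank_tr M)
    (mxrank_tr (adjoint_mx G)).
move=> h; have /submxP[c hc] : ((adjoint_mx G *m y)^T <= M^T)%MS.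
  by apply: submx_trans h; rewrite trmx_mul submxMl.
exists c^T; apply/eqP; rewrite mulmxBr subr_eq0 mulmxA -/M; apply/eqP.
by apply: trmx_inj; rewrite hc [RHS]trmx_mul trmxK.
Qed.

End AdjointTheory.

(** * Unitary diagonalization of Hermitian matrices over both fields *)

Section SpectralTheorem.
Context {R : realType}.

Lemma adjoint_mx_to_complex (k : scalar_kind) m n (A : 'M[scalars R k]_(m, n)) :
  adjoint_mx (map_mx to_complex A : 'M[scalars R ComplexScalars]_(m, n)) =
  map_mx to_complex (adjoint_mx A).
Proof. by apply/matrixP => i j; rewrite !mxE to_complex_conj. Qed.

(** The number [w^* A w] equals both [z |w|^2] and its conjugate. *)
Lemma hermitian_eigenvalue_real n (A : 'M[scalars R ComplexScalars]_n)
    (w : 'cV[scalars R ComplexScalars]_n) (z : R[i]) :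
  is_hermitian A -> w != 0 -> A *m w = z *: w -> z = (complex.Re z)%:C%C.
Proof.
move=> hA w0 Aw; pose s := of_real ComplexScalars (norm_sqr w).
have e1 : adjoint_mx w *m A *m w = z *: s%:M.
  by rewrite -mulmxA Aw -scalemxAr adjoint_mulmx_norm_sqr.
have e2 : adjoint_mx w *m A *m w = z^*%C *: s%:M.
  rewrite -{1}hA -adjoint_mxM Aw -[s%:M]adjoint_mulmx_norm_sqr scalemxAl.
  by congr (_ *m _); apply/matrixP => i j; rewrite !mxE rmorphM.
have s0 : s != 0.
  by rewrite fmorph_eq0; apply: contra w0 => /eqP/norm_sqr_eq0 ->.
have : z * s = z^*%C * s.
  by move: e2; rewrite e1 => /matrixP/(_ 0 0); rewrite !mxE eqxx !mulr1n.
move=> /(mulIf s0); case: z {Aw e1 e2} => a b [] /eqP.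
by rewrite -addr_eq0 -mulr2n mulrn_eq0 /= => /eqP ->.
Qed.

Context {k : scalar_kind}.
Local Notation F := (scalars R k).
Local Notation re := (@of_real R k).

(** [C] is the matrix of [A] on the invariant column space of [Q]. A complex eigenvector of [C] is
    carried by [Q] to one of [A], which forces its eigenvalue to be real. *)
Lemma hermitian_invariant_eigenvector m n (A : 'M[F]_n) (Q : 'M[F]_(n, m))
    (C : 'M[F]_m) :
  is_hermitian A -> (0 < m)%N -> \rank Q = m -> A *m Q = Q *m C ->
  exists (l : R) (c : 'cV[F]_m), c != 0 /\ C *m c = re l *: c.
Proof.
move=> hA m0 rQ AQ.
have [z rz] : exists z : R[i], root (char_poly (map_mx to_complex C^T)) z.
  by apply/closed_rootP; rewrite size_char_poly eqSS -lt0n.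
have := rz; rewrite -eigenvalue_root_char => /eigenvalueP[v vC v0].
pose w : 'cV[scalars R ComplexScalars]_n := map_mx to_complex Q *m v^T.
have w0 : w != 0.
  have rQ' : row_free (map_mx (@to_complex R k) Q)^T.
    by rewrite /row_free mxrank_tr mxrank_map rQ.
  apply: contra v0 => /eqP/(congr1 trmx); rewrite trmx_mul trmxK trmx0.
  by rewrite -(mul0mx _ ((map_mx (@to_complex R k) Q)^T)) => /(row_free_inj rQ')/eqP.
have zE : z = (complex.Re z)%:C%C.
  apply: (@hermitian_eigenvalue_real _ (map_mx to_complex A) w) => //.
    by rewrite /is_hermitian adjoint_mx_to_complex hA.
  rewrite /w mulmxA -map_mxM AQ map_mxM -mulmxA scalemxAr; congr (_ *m _).
  by apply: trmx_inj; rewrite trmx_mul trmxK map_trmx vC linearZ/= trmxK.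
(* Being real, the root already lies in [F], so it has an eigenvector over [F] itself. *)
have : root (char_poly C^T) (re (complex.Re z)).
  by rewrite -(fmorph_root to_complex) map_char_poly
    [X in root _ X]to_complex_of_real -zE.
rewrite -eigenvalue_root_char => /eigenvalueP[c cC c0].
exists (complex.Re z), c^T; split; first by rewrite -trmx0 (inj_eq trmx_inj).
by apply: trmx_inj; rewrite trmx_mul trmxK cC linearZ/= trmxK.
Qed.

(** Induction on [m]: the orthogonal complement of the eigenvectors found so far
    is [A]-invariant, so it contains a further eigenvector. *)
Lemma orthonormal_eigenvectors n (A : 'M[F]_n) m : is_hermitian A -> (m <= n)%N ->
  exists (U : 'M[F]_(n, m)) (d : 'rV[R]_m),
    adjoint_mx U *m U = 1%:M /\ A *m U = U *m diag_mx (map_mx re d).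
Proof.
move=> hA; elim: m => [|m IH] mn.
  by exists 0, 0; split; apply/matrixP => i [].
have [U [d [UU AU]]] := IH (ltnW mn).
(* The columns of [Q] form a basis of the orthogonal complement of the columns of [U]. *)
pose K := kermx (adjoint_mx U)^T; pose Q := (row_base K)^T.
have r0 : (0 < \rank K)%N.
  by rewrite mxrank_ker subn_gt0 (leq_ltn_trans (rank_leq_col _)).
have UQ : adjoint_mx U *m Q = 0.
  apply: trmx_inj; rewrite trmx_mul trmxK trmx0; apply/sub_kermxP.
  by rewrite eq_row_base.
have rQ : \rank Q = \rank K by rewrite mxrank_tr; exact/eqP/row_base_free.
(* Invariance of the complement: [U^* A Q = (A U)^* Q], and [A U = U D] with [D] diagonal reduces
   this to [U^* Q = 0]. *)
have : ((A *m Q)^T <= row_base K)%MS.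
  rewrite eq_row_base; apply/sub_kermxP.
  rewrite -trmx_mul mulmxA -{1}hA -adjoint_mxM AU adjoint_mxM -mulmxA UQ mulmx0.
  exact: trmx0.
move=> /submxP[C hC].
have AQ : A *m Q = Q *m C^T by apply: trmx_inj; rewrite hC [RHS]trmx_mul !trmxK.
have [l [c [c0 Cc]]] := hermitian_invariant_eigenvector hA r0 rQ AQ.
pose w := Q *m c.
have w0 : w != 0.
  apply: contra c0 => /eqP/(congr1 trmx); rewrite trmx_mul trmxK trmx0.
  rewrite -(mul0mx _ (row_base K)) => /(row_free_inj (row_base_free K)).
  by move=> /(congr1 trmx); rewrite trmxK trmx0 => ->.
have Aw : A *m w = re l *: w by rewrite /w mulmxA AQ -mulmxA Cc scalemxAr.
have Uw : adjoint_mx U *m w = 0 by rewrite mulmxA UQ mul0mx.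
have N0 : 0 < norm_sqr w.
  by rewrite lt0r norm_sqr_ge0 andbT; apply: contra w0 => /eqP/norm_sqr_eq0 ->.
pose a := (Num.sqrt (norm_sqr w))^-1; pose u := re a *: w.
have adju : adjoint_mx u = re a *: adjoint_mx w.
  by apply/matrixP => i j; rewrite !mxE rmorphM /= conj_of_real.
have uu : adjoint_mx u *m u = 1%:M.
  rewrite adju -scalemxAl -scalemxAr adjoint_mulmx_norm_sqr !scale_scalar_mx.
  rewrite -!rmorphM /= mulrA -expr2 exprVn sqr_sqrtr ?norm_sqr_ge0//.
  by rewrite mulVf ?gt_eqF// rmorph1.
have Uu : adjoint_mx U *m u = 0 by rewrite -scalemxAr Uw scaler0.
have uU : adjoint_mx u *m U = 0.
  by rewrite -[U]adjoint_mxK -adjoint_mxM Uu adjoint_mx0.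
have UU' : adjoint_mx (row_mx u U) *m row_mx u U = 1%:M.
  by rewrite adjoint_row_mx mul_col_row uu UU Uu uU -scalar_mx_block.
have AU' : A *m row_mx u U =
    row_mx u U *m diag_mx (map_mx re (row_mx l%:M d)).
  rewrite map_row_mx diag_mx_row mul_mx_row mul_row_block !mulmx0 addr0 add0r.
  rewrite -AU map_scalar_mx /=.
  have -> : diag_mx (re l)%:M = (re l)%:M :> 'M[F]_1 .
    by apply/matrixP => i j; rewrite !ord1 !mxE.
  by rewrite mul_mx_scalar -scalemxAr Aw scalerA mulrC -scalerA.
by exists (row_mx u U), (row_mx l%:M d).
Qed.

Lemma spectral_theorem n (A : 'M[F]_n) : is_hermitian A ->
  exists (U : 'M[F]_n) (d : 'rV[R]_n), U *m adjoint_mx U = 1%:M /\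
    A = U *m diag_mx (map_mx re d) *m adjoint_mx U.
Proof.
move=> hA; have [U [d [/mulmx1C UU AU]]] := orthonormal_eigenvectors hA (leqnn n).
by exists U, d; split => //; rewrite -AU -mulmxA UU mulmx1.
Qed.

End SpectralTheorem.

(** * Minimizers, their normal equations and their dependence on the shift *)

Section Minimizer.
Context {R : realType} {k : scalar_kind} {n : nat}.
Local Notation F := (scalars R k).
Local Notation re := (@of_real R k).
Implicit Types (A U : 'M[F]_n) (S T : {vspace 'cV[F]_n}) (b x : 'cV[F]_n) (w : R).

Lemma eigenvalue_diagonalized A U (d : 'rV[R]_n) :
  U *m adjoint_mx U = 1%:M ->
  A = U *m diag_mx (map_mx re d) *m adjoint_mx U ->
  forall a, eigenvalue A a <-> exists j, a = re (d 0 j).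
Proof.
move=> UU AE a; have UU' := mulmx1C UU; split=> [/eigenvalueP[v vA v0]|[j ->]].
  have vU0 : v *m U != 0.
    by apply: contra v0 => /eqP vU; rewrite -[v]mulmx1 -UU mulmxA vU mul0mx.
  have /rV0Pn[j vUj] := vU0.
  exists j; have : v *m U *m diag_mx (map_mx re d) = a *: (v *m U).
    by rewrite scalemxAl -vA {1}AE !mulmxA -[RHS]mulmxA UU' mulmx1.
  rewrite mul_mx_diag => /matrixP/(_ 0 j); rewrite mxE [RHS]mxE mulrC => /(mulIf vUj).
  by rewrite mxE.
apply/eigenvalueP; exists (row j (adjoint_mx U)); last first.
  apply/eqP => rj; have : row j (adjoint_mx U *m U) = 0 by rewrite row_mul rj mul0mx.
  move=> /matrixP/(_ 0 j); rewrite UU' !mxE eqxx => /eqP; exact/negP/oner_neq0.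
rewrite {1}AE !mulmxA -row_mul UU' row1 -rowE row_diag_mx -scalemxAl -rowE.
by rewrite mxE.
Qed.

(** The least diagonal entry of a spectral decomposition meets the specification in [lambda_min], so
    the choice there does not fall back on its default. *)
Lemma lambda_minP A : is_hermitian A -> (0 < n)%N ->
  forall a, eigenvalue A a -> re (lambda_min A) <= a.
Proof.
move=> hA n0; have [U [d [UU AE]]] := spectral_theorem hA.
have eigE := eigenvalue_diagonalized UU AE.
suff ex : exists l, [set l | eigenvalue A (re l) /\
    forall m : F, eigenvalue A m -> re l <= m] l.
  by have [_] := xgetPex 0 ex.
pose j := [arg min_(i < Ordinal n0) d 0 i]%O.
exists (d 0 j); split; first by apply/eigE; exists j.
move=> _ /eigE[i ->]; rewrite of_real_le /j.
by case: arg_minP => //= i' _; exact.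
Qed.

Lemma shifted_mx_hermitian A w : is_hermitian A -> is_hermitian (shifted_mx A w).
Proof.
move=> hA; rewrite /is_hermitian /shifted_mx adjoint_mxD hA; congr (_ + _).
by rewrite /adjoint_mx map_scalar_mx /= conj_of_real tr_scalar_mx.
Qed.

(** The inverse square root enters the later arguments only through this identity, which holds for
    whichever decomposition the choice in [hpd_power] selects. *)
Lemma hpd_power_shifted A w : is_hermitian A -> (0 < n)%N -> omega_min A < w ->
  let P := hpd_power (shifted_mx A w) (- 2^-1) in
  adjoint_mx P *m P *m shifted_mx A w = 1%:M.
Proof.
move=> hA n0 hw /=; rewrite /hpd_power; set B := shifted_mx A w.
have [U0 [d0 [UU0 AE0]]] := spectral_theorem (shifted_mx_hermitian w hA).
set X := [set P | _].
have /(xgetPex 0) : exists P, X P by eexists; exists U0, d0.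
move: (xget 0 X) => P [U [d [UU AE ->]]].
have UU' := mulmx1C UU.
(* Each [d 0 j - w] is an eigenvalue of [A], hence at least [lambda_min A], which exceeds [- w]. *)
have dgt0 j : 0 < d 0 j.
  have /eigenvalueP[v vB v0] : eigenvalue B (re (d 0 j)).
    by apply/(eigenvalue_diagonalized UU AE); exists j.
  have : eigenvalue A (re (d 0 j - w)).
    apply/eigenvalueP; exists v => //.
    move: vB; rewrite /B /shifted_mx mulmxDr mul_mx_scalar => /eqP.
    by rewrite eq_sym -subr_eq rmorphB scalerBl => /eqP.
  move=> /(lambda_minP hA n0); rewrite of_real_le -subr_ge0.
  by move: hw; rewrite /omega_min; lra.
set D := \row_j _; have -> : D = map_mx re (\row_j (d 0 j `^ (- 2^-1))).
  by apply/rowP => j; rewrite !mxE.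
rewrite AE !adjoint_mxM adjoint_mxK adjoint_diag_real !mulmxA.
rewrite -(mulmxA _ (adjoint_mx U) U) UU' mulmx1.
rewrite -(mulmxA _ (adjoint_mx U) U) UU' mulmx1.
rewrite -(mulmxA U) -(mulmxA U) !mulmx_diag.
set E := diag_mx _; have -> : E = 1%:M; last by rewrite mulmx1.
rewrite /E -diag_const_mx; congr diag_mx; apply/rowP => j; rewrite !mxE -!rmorphM.
rewrite powRN powR12_sqrt ?ltW// -invfM -expr2 sqr_sqrtr ?ltW//.
by rewrite mulVf ?gt_eqF// rmorph1.
Qed.

(** Least squares for [P V], where the columns of [V] are a basis of [T]. Taking [P] to be the
    inverse square root yields minimizers; [P = 1] gives the ordinary orthogonal projection. *)
Lemma orthogonal_projection (P : 'M[F]_n) T b : exists2 t, t \in T &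
  forall s, s \in T -> adjoint_mx (P *m s) *m (P *m (b - t)) = 0.
Proof.
pose V : 'M[F]_(n, \dim T) := \matrix_(i, j) (vbasis T)`_j i 0.
have VE c : V *m c = \sum_j c j 0 *: (vbasis T)`_j.
  apply/colP => i; rewrite mxE summxE; apply: eq_bigr => j _.
  by rewrite !mxE mulrC.
have [c hc] := normal_equation_solvable (P *m V) (P *m b).
exists (V *m c).
  rewrite VE; apply: memv_suml => j _; apply/memvZ/vbasis_mem/mem_nth.
  by rewrite size_tuple.
move=> s sT; have -> : s = V *m (\col_j coord (vbasis T) j s).
  by rewrite {1}(coord_vbasis sT) VE; apply: eq_bigr => j _; rewrite mxE.
rewrite mulmxBr mulmxA [X in _ - X]mulmxA adjoint_mxM -mulmxA.
by rewrite mulmxA -mulmxA hc mulmx0.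
Qed.

(** First-order optimality condition for [objective]. It is linear in the pair of [b] and [x]. *)
Definition normal_equation A S b w x :=
  forall s, s \in S ->
    adjoint_mx (A *m s) *m (invmx (shifted_mx A w) *m (b - A *m x)) = 0.

Section Shifted.
Variables (A : 'M[F]_n) (w : R).
Hypotheses (hA : is_hermitian A) (uA : A \in unitmx) (n0 : (0 < n)%N).
Hypothesis hw : omega_min A < w.
Let P := hpd_power (shifted_mx A w) (- 2^-1).

Lemma shifted_mx_unit : shifted_mx A w \in unitmx.
Proof. by have /mulmx1_unit[] := hpd_power_shifted hA n0 hw. Qed.

Lemma invmx_shifted : invmx (shifted_mx A w) = adjoint_mx P *m P.
Proof.
by rewrite -[LHS]mul1mx -(hpd_power_shifted hA n0 hw) mulmxK ?shifted_mx_unit.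
Qed.

Lemma inv_sqrt_inj x : P *m x = 0 -> x = 0.
Proof.
have : P \in unitmx.
  have := hpd_power_shifted hA n0 hw; rewrite /= -mulmxA.
  by move=> /mulmx1_unit[_]; rewrite unitmx_mul => /andP[].
by move=> uP Px; rewrite -[x](mulKmx uP) -/P Px mulmx0.
Qed.

Lemma invmx_shifted_form (u v : 'cV[F]_n) :
  adjoint_mx u *m (invmx (shifted_mx A w) *m v) = adjoint_mx (P *m u) *m (P *m v).
Proof. by rewrite invmx_shifted adjoint_mxM !mulmxA. Qed.

Lemma invmx_shifted_form_eq0 (u : 'cV[F]_n) :
  adjoint_mx u *m (invmx (shifted_mx A w) *m u) = 0 -> u = 0.
Proof.
by rewrite invmx_shifted_form => /adjoint_mulmx_self_eq0/inv_sqrt_inj.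
Qed.

(** By Pythagoras the squared objective at [y] exceeds that at [x] by [|P A (x - y)|^2], which
    vanishes only for [y = x] because [P] and [A] are injective. *)
Lemma normal_equation_minimizer S b x :
  x \in S -> normal_equation A S b w x -> minimizer A S b w = x.
Proof.
move=> xS ex.
have pyth y : y \in S -> norm_sqr (P *m (b - A *m y)) =
    norm_sqr (P *m (A *m (x - y))) + norm_sqr (P *m (b - A *m x)).
  move=> yS; rewrite -norm_sqrD_orthogonal; last first.
    by rewrite -invmx_shifted_form ex// memvB.
  by rewrite -mulmxDr [A *m (x - y)]mulmxBr [in RHS]addrC addrA subrK.
apply: xget_unique => [|y [yS miny]].
  split=> // y yS; rewrite /objective ler_sqrt ?norm_sqr_ge0//.
  by rewrite [leRHS]pyth// lerDr norm_sqr_ge0.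
have := miny _ xS; rewrite /objective ler_sqrt ?norm_sqr_ge0//.
rewrite [leLHS]pyth// gerDr => N0.
have /norm_sqr_eq0/inv_sqrt_inj : norm_sqr (P *m (A *m (x - y))) = 0.
  by apply/eqP; rewrite eq_le N0 norm_sqr_ge0.
by move=> /(congr1 (mulmx (invmx A))); rewrite mulKmx// mulmx0 => /subr0_eq.
Qed.

Lemma minimizer_spec S b :
  minimizer A S b w \in S /\ normal_equation A S b w (minimizer A S b w).
Proof.
pose T := (linfun (mulmx A) @: S)%VS.
have [t /memv_imgP[x xS ->] ht] := orthogonal_projection P T b.
suff ex : normal_equation A S b w x by rewrite (normal_equation_minimizer xS ex).
move=> s sS; rewrite invmx_shifted_form.
have := ht (A *m s); rewrite lfunE; apply.
by apply/memv_imgP; exists s => //; rewrite lfunE.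
Qed.

End Shifted.

(** A hull of dimension 0 is a single point, so all minimizers coincide with it. This replaces a
    condition on hulls by linear equations with one common solution. *)
Lemma has_affine_dim0_minimizer_hull A S b :
  is_hermitian A -> A \in unitmx -> (0 < n)%N ->
  has_affine_dim (minimizer_hull A S b) 0 <->
  exists2 x, x \in S & forall w, omega_min A < w -> normal_equation A S b w x.
Proof.
move=> hA uA n0; split.
  move=> [x0 [U [/eqP]]]; rewrite dimv_eq0 => /eqP -> hull.
  have minE w : omega_min A < w -> minimizer A S b w = x0.
    move=> hw; have : minimizer_hull A S b (minimizer A S b w).
      exists 1%N, (fun=> 1), (fun=> minimizer A S b w).
      by split=> [_||]; rewrite ?big_ord1 ?scale1r//; exists w.
    by rewrite hull => -[u /=]; rewrite memv0 => /eqP ->; rewrite addr0.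
  have w1 : omega_min A < omega_min A + 1 by rewrite ltrDl.
  exists x0; first by rewrite -(minE _ w1); have [] := minimizer_spec hA uA n0 w1 S b.
  by move=> w hw; rewrite -(minE _ hw); have [] := minimizer_spec hA uA n0 hw S b.
move=> [x xS ex]; exists x, 0%VS; split; first exact: dimv0.
have minE w : omega_min A < w -> minimizer A S b w = x.
  by move=> hw; apply: normal_equation_minimizer => //; exact: ex.
apply/seteqP; split=> y.
  move=> [m [c [z [hz c1 ->]]]]; exists 0; first exact: mem0v.
  rewrite addr0 -[LHS]scale1r -c1 scaler_suml; apply: eq_bigr => i _.
  by have [w hw <-] := hz i; rewrite minE.
move=> [u /=]; rewrite memv0 => /eqP -> <-; rewrite addr0.
exists 1%N, (fun=> 1), (fun=> x).
split=> [_||]; rewrite ?big_ord1 ?scale1r//.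
(* Any admissible shift will do here; it shows that the hull is non-empty. *)
have w1 : omega_min A < omega_min A + 1 by rewrite ltrDl.
by exists (omega_min A + 1) => //; rewrite minE.
Qed.

(** With [t] the projection of [x] onto [T], the vector [u = x - t] is orthogonal to [T], hence by
    hypothesis to [x], hence to itself. *)
Lemma orthogonal_bidual T x :
  (forall u : 'cV[F]_n, (forall t, t \in T -> adjoint_mx t *m u = 0) ->
    adjoint_mx u *m x = 0) ->
  x \in T.
Proof.
move=> hx; have [t tT ht] := orthogonal_projection 1%:M T x.
have ut s : s \in T -> adjoint_mx s *m (x - t) = 0.
  by move=> /ht; rewrite !mul1mx.
suff /adjoint_mulmx_self_eq0/subr0_eq -> : adjoint_mx (x - t) *m (x - t) = 0 by [].
rewrite mulmxBr hx// -[t in adjoint_mx _ *m t]adjoint_mxK -adjoint_mxM.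
by rewrite ut// adjoint_mx0 subr0.
Qed.

Lemma constant_minimizer_proper A S :
  is_hermitian A -> A \in unitmx -> (0 < n)%N -> (1 <= Ind A S)%N ->
  exists b, ~ has_affine_dim (minimizer_hull A S b) 0.
Proof.
move=> hA uA n0 indA; apply: contrapT => /forallNP allB.
pose T := (linfun (mulmx A) @: S)%VS.
have memT s : s \in S -> A *m s \in T.
  by move=> sS; apply/memv_imgP; exists s; rewrite ?lfunE.
pose w1 := omega_min A + 1; pose w2 := omega_min A + 2.
have hw1 : omega_min A < w1 by rewrite ltrDl.
have hw2 : omega_min A < w2 by rewrite ltrDl.
have w12 : w1 != w2 by rewrite /w1 /w2 (inj_eq (addrI _)) eq_sym (eqr_nat _ 2 1).
pose H w := invmx (shifted_mx A w).
have uw1 := shifted_mx_unit hA n0 hw1; have uw2 := shifted_mx_unit hA n0 hw2.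
have Hperp (u : 'cV[F]_n) : (forall t, t \in T -> adjoint_mx t *m u = 0) ->
    forall t, t \in T -> adjoint_mx t *m (H w2 *m u) = 0.
  move=> uT t tT; have /contrapT := allB (shifted_mx A w1 *m u).
  move=> /(has_affine_dim0_minimizer_hull _ _ hA uA n0)[x xS ex].
  (* At [w1] the inverse cancels the shift in [b] and leaves [u], which is orthogonal to [A x];
     testing with [s = x] isolates the definite form at [A x]. *)
  have Ax0 : A *m x = 0.
    apply: (invmx_shifted_form_eq0 hA n0 hw1).
    have := ex _ hw1 _ xS; rewrite mulmxBr mulKmx// mulmxBr uT ?memT//.
    by rewrite sub0r => /eqP; rewrite oppr_eq0 => /eqP.
  have [s sS tE] := memv_imgP tT; have := ex _ hw2 _ sS.
  rewrite Ax0 subr0 -[A *m s](lfunE (mulmx A)) -tE.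
  (* Under [H w2] the first summand becomes [u], orthogonal to [T]; the second survives with the
     non-zero factor [w1 - w2]. *)
  have -> : shifted_mx A w1 *m u = shifted_mx A w2 *m u + of_real k (w1 - w2) *: u.
    rewrite /shifted_mx !mulmxDl !mul_scalar_mx -addrA -scalerDl -rmorphD.
    by rewrite addrCA subrr addr0.
  rewrite mulmxDr mulKmx// mulmxDr uT// add0r -!scalemxAr => /eqP.
  by rewrite scaler_eq0 fmorph_eq0 subr_eq0 (negPf w12) => /eqP.
(* Injectivity of [H w2] makes the dimensions agree, so one inclusion suffices. Self-adjointness
   transfers the invariance from the orthogonal complement to [T]. *)
have HT : (linfun (mulmx (H w2)) @: T)%VS = T.
  apply/eqP; rewrite eqEdim limg_dim_eq ?leqnn ?andbT; last first.
    apply/eqP; rewrite -subv0; apply/subvP => v.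
    rewrite memv_cap memv_ker lfunE/= memv0 => /andP[_ /eqP Hv].
    by rewrite -[v](mulKVmx uw2) -/(H w2) Hv mulmx0.
  apply/subvP => _ /memv_imgP[t tT ->]; rewrite lfunE/=.
  apply: orthogonal_bidual => u uT.
  rewrite -[LHS]adjoint_mxK adjoint_mxM adjoint_mxK.
  have hH : adjoint_mx (H w2) = H w2.
    by rewrite /H invmx_shifted// adjoint_mxM adjoint_mxK.
  by rewrite [adjoint_mx (_ *m t)]adjoint_mxM hH -mulmxA Hperp// adjoint_mx0.
have AS s : s \in S -> A *m s \in S.
  (* Writing [A s = H w2 t] gives [t = A (A s) + w2 A s], so [A (A s)] lies in [T], the image of
     [S]; cancelling [A] puts [A s] in [S]. *)
  move=> sS; have : A *m s \in (linfun (mulmx (H w2)) @: T)%VS by rewrite HT memT.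
  move=> /memv_imgP[t tT]; rewrite lfunE/= => As.
  have tE : t = A *m (A *m s) + of_real k w2 *: (A *m s).
    by rewrite -mul_scalar_mx -mulmxDl As mulKVmx.
  have : A *m (A *m s) \in T.
    rewrite -(addrK (of_real k w2 *: (A *m s)) (A *m (A *m s))) -tE.
    by rewrite memvB// memvZ// memT.
  move=> /memv_imgP[s' s'S]; rewrite lfunE/= => /(congr1 (mulmx (invmx A))).
  by rewrite !mulKmx// => ->.
move: indA; rewrite /Ind.
have /addv_idPl -> : (linfun (mulmx A) @: S <= S)%VS.
  by apply/subvP => _ /memv_imgP[s sS ->]; rewrite lfunE/= AS.
by rewrite subnn.
Qed.

End Minimizer.

(** Among the subspaces contained in [P], one of maximal dimension is all of [P]: a missing vector
    could be adjoined to enlarge it. *)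
Lemma vspace_of_linear_closed (F : fieldType) (V : vectType F) (P : set V) :
  P 0 -> (forall a u v, P u -> P v -> P (a *: u + v)) ->
  exists W : {vspace V}, P = [set v | v \in W].
Proof.
move=> P0 PD.
pose sub (d : nat) := `[< exists W : {vspace V},
  \dim W = d /\ forall v, v \in W -> P v >].
have ex0 : exists d, sub d.
  exists 0%N; apply/asboolP; exists 0%VS; rewrite dimv0; split=> // v.
  by rewrite memv0 => /eqP ->.
have bnd d : sub d -> (d <= \dim {:V})%N.
  by move=> /asboolP[W [<- _]]; exact/dimvS/subvf.
case: (ex_maxnP ex0 bnd) => d /asboolP[W [dW WP]] dmax.
exists W; apply/seteqP; split=> v /=; last exact: WP.
move=> Pv; apply: contrapT => /negP vW.
have /dmax : sub (\dim (W + <[v]>)).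
  apply/asboolP; exists (W + <[v]>)%VS; split=> // x.
  move=> /memv_addP[u uW [y /vlineP[a ->] ->]].
  by rewrite addrC; apply: PD => //; exact: WP.
rewrite -dW leqNgt => /negP; apply.
rewrite ltn_neqAle dimvS ?addvSl// andbT; apply: contra vW => /eqP dE.
have /eqP -> : W == (W + <[v]>)%VS by rewrite eqEdim addvSl -dE leqnn.
exact: (subvP (addvSr W _)) (memv_line v).
Qed.

(** * Hyperplanes have Lebesgue measure zero *)

Section NullHyperplanes.
Context {R : realType}.
Local Notation RT := (measurableTypeR R).

Lemma measurable_hyperplane N (a : 'I_N -> R) (c : R) :
  measurable [set t : N.-tuple RT | \sum_i a i * tnth t i = c].
Proof.
pose f (t : N.-tuple RT) : RT := \sum_i a i * tnth t i.
have mf : measurable_fun setT f.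
  apply: (@measurable_sum _ _ _ _ _ _
    (fun i (t : N.-tuple RT) => a i * tnth t i : RT)) => i.
  apply: measurable_funM => //; exact: measurable_tnth.
rewrite [X in measurable X](_ : _ = setT `&` f @^-1` [set c]); last by rewrite setTI.
exact: mf.
Qed.

(** Induction by slicing along the first coordinate. If a later coefficient is non-zero, every slice
    is a hyperplane of lower dimension with offset [c - a ord0 * x], hence the general [c].
    Otherwise the set is a point times the whole space. *)
Lemma lebesgue_measure_n_hyperplane N (a : 'I_N -> R) (c : R) :
  (exists i, a i != 0) ->
  @lebesgue_measure_n R N [set t | \sum_i a i * tnth t i = c] = 0%E.
Proof.
elim: N a c => [a c [[]]//|N IH a c [i ai]].
rewrite [LHS]/= /pushforward.
have sumS (xt : RT * N.-tuple RT) : \sum_i a i * tnth (tuple_cons xt) i =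
    a ord0 * xt.1 + \sum_j a (lift ord0 j) * tnth xt.2 j.
  rewrite big_ord_recl; congr (_ + _); apply: eq_bigr => j _; congr (_ * _).
  exact: tnthS.
set E := _ @^-1` _.
have EE : E = [set xt : RT * N.-tuple RT |
    a ord0 * xt.1 + \sum_j a (lift ord0 j) * tnth xt.2 j = c].
  by apply/seteqP; split=> xt; rewrite /E /= sumS.
have [[j aj]|/forallNP a0] := pselect (exists j, a (lift ord0 j) != 0).
  rewrite [LHS]/product_measure1; apply: integral0_eq => x _ /=.
  rewrite -[RHS](IH (fun j => a (lift ord0 j)) (c - a ord0 * x)); last by exists j.
  congr lebesgue_measure_n; apply/seteqP; split=> t; rewrite /xsection /= inE EE /=.
    by move=> <-; rewrite addrAC subrr add0r.
  by move=> ->; rewrite addrC subrK.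
have aS j : a (lift ord0 j) = 0 by apply/eqP; have /negP := a0 j; rewrite negbK.
have a00 : a ord0 != 0.
  by move: ai; case: (unliftP ord0 i) => [j ->|->//]; rewrite aS eqxx.
have -> : E = [set c / a ord0] `*` setT.
  rewrite EE; apply/seteqP; split=> -[x t] /=; rewrite big1 ?addr0 => [|j _].
  - by move=> <-; rewrite mulrAC divff// mul1r.
  - by rewrite aS mul0r.
  - by move=> [-> _]; rewrite mulrC divfK.
  - by rewrite aS mul0r.
rewrite [LHS]product_measure1E//=.
by rewrite lebesgue_measure_set1 mul0e.
Qed.

(** Orthogonality to [r] implies a single non-trivial real linear equation in the real
    coordinates. *)
Lemma lebesgue_null_orthogonal k n (r : 'cV[scalars R k]_n)
    (E : set 'cV[scalars R k]_n) : r != 0 ->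
  E `<=` [set v | adjoint_mx r *m v = 0] -> lebesgue_null E.
Proof.
move=> /cV0Pn[i0 ri0] Er.
suff [a ha Ea] : exists2 a : 'I_(real_dim k n) -> R, exists i, a i != 0 &
    forall v : 'cV_n, adjoint_mx r *m v = 0 ->
      \sum_i a i * tnth (real_coords v) i = 0.
  exists [set t | \sum_i a i * tnth t i = 0]; split.
  - exact: measurable_hyperplane.
  - exact: lebesgue_measure_n_hyperplane.
  - by move=> _ [v /Er /Ea h <-].
have coord (v : 'cV_n) : adjoint_mx r *m v = 0 ->
    \sum_i conj_scalar (r i 0) * v i 0 = 0.
  move=> /matrixP/(_ 0 0); rewrite !mxE => rv; rewrite -[RHS]rv.
  by apply: eq_bigr => i _; rewrite !mxE.
case: k r i0 ri0 E Er coord => [|] r i0 ri0 _ _ coord.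
  exists (fun i => r i 0); first by exists i0.
  move=> v /coord rv; rewrite -[RHS]rv; apply: eq_bigr => i _.
  by congr (_ * _); exact: tnth_mktuple.
(* Coefficients of the real part of [r^* v], the sum of the terms
   [Re r_i Re v_i + Im r_i Im v_i]. *)
pose a (i : 'I_(n + n)) := match fintype.split i with
  | inl i => complex.Re (r i 0)
  | inr i => complex.Im (r i 0)
  end.
exists a.
  have : (complex.Re (r i0 0) != 0) || (complex.Im (r i0 0) != 0).
    by move: ri0; rewrite eq_complex negb_and.
  move=> /orP[h|h]; [exists (lshift n i0)|exists (rshift n i0)].
    by rewrite /a (unsplitK (inl i0)).
  by rewrite /a (unsplitK (inr i0)).
have splitE (f : 'I_(n + n) -> R) :
    \sum_i f i = \sum_(i < n) (f (lshift n i) + f (rshift n i)).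
  by rewrite big_split_ord big_split.
move=> v /coord/(congr1 (@complex.Re R)); rewrite raddf_sum => rv.
rewrite -[RHS]rv [LHS]splitE; apply: eq_bigr => i _ /=.
have -> : tnth (@real_coords R ComplexScalars n v) (lshift n i) = complex.Re (v i 0).
  by rewrite [LHS]tnth_lshift; exact: tnth_mktuple.
have -> : tnth (@real_coords R ComplexScalars n v) (rshift n i) = complex.Im (v i 0).
  by rewrite [LHS]tnth_rshift; exact: tnth_mktuple.
rewrite /a (unsplitK (inl i)) (unsplitK (inr i)).
by case: (r i 0) (v i 0) => [x1 y1] [x2 y2] /=; rewrite mulNr opprK.
Qed.

End NullHyperplanes.

(** * The subspace of right-hand sides with constant minimizer *)

Theorem corollary4p6 (R : realType) (k : scalar_kind) (n p : nat)
    (A : 'M[scalars R k]_n) (S : {vspace 'cV[scalars R k]_n}) :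
  is_hermitian A -> A \in unitmx ->
  \dim S = p -> (1 <= p <= n)%N ->
  (1 <= Ind A S)%N ->
  let B := [set b : 'cV[scalars R k]_n |
              has_affine_dim (minimizer_hull A S b) 0] in
  (exists2 W : {vspace 'cV[scalars R k]_n},
     W <> 0%VS & B = [set b | b \in W]) /\
  lebesgue_null B.
Proof.
move=> hA uA dS /andP[p0 pn] indA B.
have n0 : (0 < n)%N := leq_trans p0 pn.
have BP b : B b <-> exists2 x, x \in S &
    forall w, omega_min A < w -> normal_equation A S b w x.
  exact: has_affine_dim0_minimizer_hull.
(* For [b = A x] the residual at [x] is zero, whatever the shift. *)
have BA x : x \in S -> B (A *m x).
  by move=> xS; apply/BP; exists x => // w _ s _; rewrite subrr !mulmx0.
have [W BW] : exists W : {vspace 'cV[scalars R k]_n}, B = [set b | b \in W].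
  apply: vspace_of_linear_closed.
    by rewrite -(mulmx0 _ A); apply: BA; exact: mem0v.
  move=> a u v /BP[x xS ux] /BP[y yS vy]; apply/BP; exists (a *: x + y).
    by rewrite memvD// memvZ.
  move=> w hw s sS; have -> : a *: u + v - A *m (a *: x + y) =
      a *: (u - A *m x) + (v - A *m y).
    by rewrite mulmxDr -scalemxAr scalerBr opprD addrACA.
  rewrite (mulmxDr (invmx _)) (mulmxDr (adjoint_mx _)) -!scalemxAr ux// vy//.
  by rewrite scaler0 addr0.
split.
  (* [A] maps the non-zero vector [vpick S] of [S] to a non-zero element of [B]. *)
  exists W => // W0; have : vpick S == 0.
    have : B (A *m vpick S) by apply: BA; exact: memv_pick.
    rewrite BW W0 /= memv0 => /eqP/(congr1 (mulmx (invmx A))).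
    by rewrite mulKmx// mulmx0 => ->.
  by rewrite vpick0 -dimv_eq0 dS eqn0Ngt p0.
have [b bB] := constant_minimizer_proper hA uA n0 indA.
(* The normal of the hyperplane is [b] minus its projection onto [W], non-zero because [b] lies
   outside [W]. *)
have [t tW tb] := orthogonal_projection 1%:M W b.
apply: (@lebesgue_null_orthogonal _ _ _ (b - t)).
  apply: contra_notN bB; rewrite subr_eq0 => /eqP bt.
  by rewrite -[has_affine_dim _ _]/(B b) BW bt.
move=> v; rewrite BW /= => /tb; rewrite !mul1mx => vb.
by rewrite -[v]adjoint_mxK -adjoint_mxM vb adjoint_mx0.
Qed.
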